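(* $\mathrm{Space}(\mathrm{FPHP}_n^{n+1})=\Omega(n)$, where $\mathrm{Space}$ denotes $\mathrm{Res}(\oplus)$ space.
   Context: $\mathrm{FPHP}_n^{n+1}$ is the CNF in the variables $p_{ij}$, $i\in[n+1]$, $j\in[n]$, consisting of: pigeon axioms $\bigvee_{j\in[n]}p_{ij}$ for every $i\in[n+1]$; hole axioms $\neg p_{ij}\lor\neg p_{i'j}$ for all $i\ne i'\in[n+1]$ and $j\in[n]$; functionality axioms $\neg p_{ij}\lor\neg p_{ij'}$ for all $i\in[n+1]$ and $j\ne j'\in[n]$. It is viewed as a linear CNF by writing $x$ as $(x=1)$, $\neg x$ as $(x=0)$. $\mathrm{Res}(\oplus)$: linear clauses are disjunctions of equations $f=\alpha$ ($f$ a linear form over $\mathbb{F}_2$, $\alpha\in\{0,1\}$); rules: from $A\lor(f=0)$ and $B\lor(f=1)$ derive $A\lor B$, and from $C$ derive any linear clause semantically implied by $C$. A refutation is a sequence of configurations (sets of linear clauses) $S_1=\emptyset,\dots,S_m$ with $S_m$ containing the empty clause, each obtained from the previous by adding a formula clause, erasing a clause, or adding a clause derived by the rules from current clauses; space is $\max_i|S_i|$, and $\mathrm{Space}$ of a formula is the minimum over its refutations. *)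

(* Defs.v *)
From mathcomp Require Import all_boot all_order all_algebra.
From mathcomp Require Import boolp.

Set Implicit Arguments.
Unset Strict Implicit.
Unset Printing Implicit Defensive.

Import GRing.Theory.

Local Open Scope ring_scope.

Section ResXor.
Variable V : finType.

(* The literal (x, true) is x and (x, false) is ~x. *)
Definition literal : finType := (V * bool)%type.
Definition clause : finType := {set literal}.
Definition cnf : finType := {set clause}.

(* A linear form over F_2 is given by its coefficients. *)
Definition linform : finType := {ffun V -> 'F_2}.

Definition linform_eval (f : linform) (x : {ffun V -> 'F_2}) : 'F_2 :=
  \sum_(v : V) f v * x v.

Definition linform_var (v : V) : linform := [ffun w => (w == v)%:R].

(* The pair (f, alpha) is the equation f = alpha. *)
Definition lineq : finType := (linform * 'F_2)%type.
Definition linclause : finType := {set lineq}.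
Definition lincnf : finType := {set linclause}.

Definition lin_of_literal (l : literal) : lineq := (linform_var l.1, l.2%:R).
Definition lin_of_clause (C : clause) : linclause :=
  [set lin_of_literal l | l in C].
Definition lin_of_cnf (phi : cnf) : lincnf := [set lin_of_clause C | C in phi].

Definition linsat (x : {ffun V -> 'F_2}) (C : linclause) : bool :=
  [exists e in C, linform_eval e.1 x == e.2].

Definition semantically_implies (C D : linclause) : Prop :=
  forall x, linsat x C -> linsat x D.

Definition empty_linclause : linclause := set0.

Definition configuration : finType := {set linclause}.
Definition empty_configuration : configuration := set0.

Inductive derivable (S : configuration) : linclause -> Prop :=
| Resolution (f : linform) (A B : linclause) :
    (f, 0) |: A \in S -> (f, 1) |: B \in S -> derivable S (A :|: B)
| Weakening (C D : linclause) :
    C \in S -> semantically_implies C D -> derivable S D.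

Inductive step (phi : lincnf) (S : configuration) : configuration -> Prop :=
| Download (C : linclause) : C \in phi -> step phi S (C |: S)
| Erasure (C : linclause) : C \in S -> step phi S (S :\ C)
| Inference (C : linclause) : derivable S C -> step phi S (C |: S).

(* The last condition forces the sequence to be nonempty. *)
Definition refutation (phi : lincnf) (pi : seq configuration) : Prop :=
  [/\ head empty_configuration pi = empty_configuration,
      forall i, (i.+1 < size pi)%N ->
        step phi (nth empty_configuration pi i)
                 (nth empty_configuration pi i.+1)
    & empty_linclause \in last empty_configuration pi].

Definition refutation_space (pi : seq configuration) : nat :=
  \max_(S <- pi) #|S|.

Definition refutable_in_space (phi : lincnf) (s : nat) : bool :=
  `[< exists pi, refutation phi pi /\ refutation_space pi = s >].

(* The minimum of the refutation spaces.  The value 0 stands for a formula with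
   no refutation: it is never attained otherwise, since a refutation reaches a
   configuration containing the empty clause.  Hence a positive lower bound on
   ResXorSpace also asserts that phi is refutable. *)
Definition ResXorSpace (phi : lincnf) : nat :=
  if pselect (exists s, refutable_in_space phi s) is left ex
  then ex_minn ex else 0%N.

End ResXor.

Section FPHP.
Variable n : nat.

Definition pvar : finType := ('I_n.+1 * 'I_n)%type.

Definition pigeon_axioms : cnf pvar :=
  [set [set ((i, j), true) | j : 'I_n] | i : 'I_n.+1].

Definition hole_axioms : cnf pvar :=
  \bigcup_(j : 'I_n)
    [set [set ((i, j), false); ((i', j), false)]
      | i in 'I_n.+1, i' in 'I_n.+1 & i != i'].

Definition functionality_axioms : cnf pvar :=
  \bigcup_(i : 'I_n.+1)
    [set [set ((i, j), false); ((i, j'), false)]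
      | j in 'I_n, j' in 'I_n & j != j'].

Definition FPHP : cnf pvar :=
  pigeon_axioms :|: hole_axioms :|: functionality_axioms.

End FPHP.

(* Main.v *)
Require Import Defs.
From mathcomp Require Import all_boot all_order all_algebra.
From mathcomp Require Import boolp zify.
Import GRing.Theory Num.Theory.

(** Points are partial matchings of pigeons to holes.  For [d <= n/2] let [I_d]
    be the span of the functions that read at most [d] pigeons, at least one of
    which they require to be unmatched: these are the consequences of degree
    [d] of the axioms in the polynomial calculus.  By the pigeon dance argument
    of Razborov and of Impagliazzo, Pudlak and Sgall, [1] is not in [I_d], and
    the functions of degree [s <= d] in [I_d] are already in [I_s].

    A configuration of [s] clauses is kept alive by attaching to each clause a
    single linear equation that implies it, in such a way that the indicator
    function of the [s] equations, which has degree at most [s], is not in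
    [I_d].  Every step of a refutation can be followed while [s + 2 <= d]:
    locality of [I_d] allows equations to be erased and added, a pigeon axiom
    gets the equation [sum_j p_ij = 1], a hole or functionality axiom one of
    [p = 0], [p' = 0], and a resolvent one of the equations spanned by those of
    its premises.  The empty clause cannot be alive, hence space at least
    [n/2 - 1]. *)

Set Implicit Arguments.
Unset Strict Implicit.
Unset Printing Implicit Defensive.

(** * Pigeon dances *)

Section Dance.
Local Open Scope nat_scope.
Variables m n : nat.

(* A partial assignment of the pigeons: at 0 the pigeon is not mentioned, at 1
   it is required to be unmatched, and the holes are numbered from 2. *)
Definition config := {ffun 'I_m.+1 -> 'I_n.+2}.
Implicit Types (a b c e h : config) (i k : 'I_m.+1) (v w : 'I_n.+2).

Definition upd a i v : config := [ffun k => if k == i then v else a k].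

(** Levels 0 and 1 are states rather than holes, so they alone may be shared. *)
Definition proper a :=
  [forall i, forall k, (i != k) ==> (a i == a k) ==> (a i <= 1)].

Definition dom a := [set i | 0 < a i].

Lemma properP a :
  reflect (forall i k, i != k -> a i = a k -> a i <= 1) (proper a).
Proof.
apply: (iffP forallP) => [H i k ik aik|H i].
  by have /forallP/(_ k)/implyP/(_ ik)/implyP/(_ (introT eqP aik)) := H i.
by apply/forallP => k; apply/implyP => ik; apply/implyP => /eqP /(H _ _ ik).
Qed.

Lemma upd_same a i : upd a i (a i) = a.
Proof. by apply/ffunP => k; rewrite ffunE; case: eqP => // ->. Qed.

Definition vacant a v := [forall k, a k != v].

Lemma upd_proper a i v : proper a -> vacant a v -> proper (upd a i v).
Proof.
move=> /properP pa /forallP va; apply/properP => k l kl; rewrite !ffunE.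
have [ki|ki] := eqVneq k i; have [li|li] := eqVneq l i.
- by rewrite ki li eqxx in kl.
- by move=> E; have := va l; rewrite E eqxx.
- by move=> E; have := va k; rewrite E eqxx.
- exact: pa.
Qed.

Definition jump a i v := vacant a v && (a i < v).

Definition next_hole a i :=
  [pick v | jump a i v & [forall w, jump a i w ==> (v <= w)]].

(** The default 0 encodes failure: a mentioned pigeon with no vacant hole above it leaves the
    domain, so a move succeeds exactly when [dom] is unchanged. *)
Definition move i a : config :=
  if a i == ord0 then a else upd a i (odflt ord0 (next_hole a i)).

Lemma move_dom i a : dom (move i a) \subset dom a.
Proof.
rewrite /move; case: eqP => // ai.
apply/subsetP => k; rewrite !inE ffunE; case: eqP => // -> _.
by rewrite lt0n; apply/eqP => E; apply: ai; apply: val_inj.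
Qed.

Lemma moveP i a : i \in dom a -> dom (move i a) = dom a ->
  exists v, [/\ move i a = upd a i v, jump a i v
    & forall w, jump a i w -> v <= w].
Proof.
move=> idom /setP/(_ i); rewrite idom inE /move.
case: eqP => [ai|_]; first by move: idom; rewrite inE ai.
rewrite /next_hole; case: pickP => [v /andP[jv /forallP mv] _|_] /=.
  by exists v; split=> // w; apply/implyP.
by rewrite ffunE eqxx.
Qed.

Lemma move_notin i a : i \notin dom a -> move i a = a.
Proof.
rewrite inE -eqn0Ngt => /eqP ai; rewrite /move ifT //.
by apply/eqP; apply: val_inj.
Qed.

Lemma move_proper i a : proper a -> dom (move i a) = dom a -> proper (move i a).
Proof.
move=> pa; have [idom|/move_notin -> //] := boolP (i \in dom a).
by case/(moveP idom) => v [-> /andP[va _] _]; apply: upd_proper.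
Qed.

(** Suppose both land on [v] and [a i < b i]. Then [b i] is a hole below [v] that no other pigeon
    occupies, so it was vacant in [a], against the minimality of [v]. *)
Lemma move_inj i a b : proper a -> proper b ->
  dom (move i a) = dom a -> dom (move i b) = dom b ->
  move i a = move i b -> a = b.
Proof.
move=> pa pb da db E.
have dab : dom a = dom b by rewrite -da E.
have [idom|iN] := boolP (i \in dom a); last first.
  by move: E; rewrite !move_notin // -dab.
have idom' : i \in dom b by rewrite -dab.
have [v [Ea /andP[va av] mva]] := moveP idom da.
have [w [Eb /andP[vb bw] mwb]] := moveP idom' db.
have vw : v = w by have /ffunP/(_ i) := E; rewrite Ea Eb !ffunE eqxx.
subst w.
have off k : k != i -> a k = b k.
  by move=> ki; have /ffunP/(_ k) := E; rewrite Ea Eb !ffunE (negPf ki).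
have clash a' b' : proper a' -> proper b' -> i \in dom a' -> i \in dom b' ->
   b' i < v -> (forall w, jump a' i w -> v <= w) ->
   (forall k, k != i -> a' k = b' k) -> (a' i < b' i) -> False.
  move=> pa' /properP pb'; rewrite !inE => a0 b0 bv mv' off' ab.
  have : jump a' i (b' i).
    rewrite /jump ab andbT; apply/forallP => k; apply/eqP => E'.
    have [ki|ki] := eqVneq k i; first by move: ab; rewrite -E' ki ltnn.
    have := pb' _ _ ki; rewrite -off' // E' => /(_ erefl); lia.
  by move/mv'; lia.
apply/ffunP => k; have [->|] := eqVneq k i; last exact: off.
apply: val_inj; case: (ltngtP (a i) (b i)) => //= [/clash|/clash] H; exfalso.
  by apply: H.
by apply: H => // k' /off.
Qed.

Fixpoint run a t : config :=
  if t is t'.+1 then move (inord t') (run a t') else a.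

Definition danceable a := proper a && (dom (run a m.+1) == dom a).

Lemma run_dom_sub a t u : t <= u -> dom (run a u) \subset dom (run a t).
Proof.
elim: u => [|u IH]; first by rewrite leqn0 => /eqP ->.
rewrite leq_eqVlt => /orP[/eqP -> //|]; rewrite ltnS => /IH; apply: subset_trans.
exact: move_dom.
Qed.

Lemma danceable_dom a t : danceable a -> t <= m.+1 -> dom (run a t) = dom a.
Proof.
case/andP => _ /eqP E tm; apply/eqP; rewrite eqEsubset (@run_dom_sub a 0 t) //=.
by rewrite -E run_dom_sub.
Qed.

Lemma danceable_proper a t : danceable a -> t <= m.+1 -> proper (run a t).
Proof.
move=> da; elim: t => [|t IH] tm; first by case/andP: da.
apply: move_proper; first exact: IH (ltnW tm).
by rewrite -/(run a t.+1) !danceable_dom // ltnW.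
Qed.

(** The moves are undone one at a time, from the last pigeon to the first. *)
Lemma run_inj : {in danceable &, injective (run^~ m.+1)}.
Proof.
move=> a b da db /= E.
suff H t : t <= m.+1 -> run a (m.+1 - t) = run b (m.+1 - t).
  by have := H m.+1 (leqnn _); rewrite subnn.
elim: t => [|t IH] tm; first by rewrite subn0.
have := IH (ltnW tm); rewrite -(@subnSK t m.+1) //= => E'.
have l1 : m.+1 - t.+1 <= m.+1 by lia.
have l2 : (m.+1 - t.+1).+1 <= m.+1 by lia.
apply: move_inj E'; rewrite ?danceable_proper //.
  by rewrite -/(run a (_.+1)) !danceable_dom.
by rewrite -/(run b (_.+1)) !danceable_dom.
Qed.

(** A mentioned pigeon starts at level 1 or higher and jumps strictly up, so after its move it is in
    a hole. *)
Lemma run_holes a t i : danceable a -> t <= m.+1 -> i < t -> run a t i != 1 :> nat.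
Proof.
move=> da; elim: t => // t IH tm it.
have [idom|iN] := boolP (inord t \in dom (run a t)); last first.
  have -> : run a t.+1 = run a t by exact: move_notin.
  move: it; rewrite ltnS leq_eqVlt => /orP[/eqP E|].
    by move: iN; rewrite -E inord_val inE -eqn0Ngt => /eqP ->.
  exact: IH (ltnW tm).
have [|v [E /andP[_ vi] _]] := moveP idom.
  by rewrite -/(run a t.+1) !danceable_dom // ltnW.
rewrite -/(run a t.+1) in E; rewrite E ffunE; have [_|iNt] := eqVneq i (inord t).
  by move: idom; rewrite inE; lia.
move: it; rewrite ltnS leq_eqVlt => /orP[/eqP it|].
  by move: iNt; rewrite -it inord_val eqxx.
exact: IH (ltnW tm).
Qed.

(* In a dance from [a] to [c] the pigeons above level [theta] move up one after
   the other, each to a vacant hole; [hybrid a c t] is the position when the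
   first [t] pigeons have moved. *)
Definition hybrid a c t : config := [ffun i : 'I_m.+1 => if i < t then c i else a i].

Definition dance theta a c :=
  (forall i, if theta < a i then a i < c i else c i == a i) /\
  (forall t, proper (hybrid a c t)).

(** * Counting the occupied levels above a given one *)

Definition occupied a x := [exists i, a i == x :> nat].

Definition crowd a x := \sum_(x.+1 <= v < n.+2) occupied a v.

Lemma occupied_upd a i v (x : nat) : proper a -> 0 < a i -> jump a i v -> 1 < x ->
  occupied (upd a i v) x + (x == a i) = occupied a x + (x == v).
Proof.
move=> /properP pa a0 /andP[/forallP va av] x1.
have [xa|xa] := eqVneq x (a i); have [xv|xv] := eqVneq x v; try lia.
- have -> : occupied a x = true by apply/existsP; exists i; rewrite xa.
  suff -> : occupied (upd a i v) x = false by [].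
  apply/negbTE/existsPn => k; rewrite ffunE; have [_|ki] := eqVneq k i.
    by rewrite eq_sym.
  apply/eqP => E; have E' : a k = a i by apply: val_inj; rewrite /= E.
  by have := pa _ _ ki E'; lia.
- have -> : occupied (upd a i v) x = true.
    by apply/existsP; exists i; rewrite ffunE eqxx xv.
  suff -> : occupied a x = false by [].
  apply/negbTE/existsPn => k; rewrite xv; apply/eqP => E.
  by have := va k; rewrite -val_eqE /= E eqxx.
- rewrite !addn0; congr nat_of_bool; apply/existsP/existsP => -[k].
    rewrite ffunE; have [_|_ E] := eqVneq k i; last by exists k.
    by rewrite eq_sym (negPf xv).
  move=> E; exists k; rewrite ffunE; have [ki|//] := eqVneq k i.
  by move: E; rewrite ki eq_sym (negPf xa).
Qed.

Lemma sum_eq_nat x y : \sum_(x.+1 <= v < n.+2) (v == y) = (x < y < n.+2).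
Proof.
elim: n.+2 => [|N IH]; first by rewrite big_geq //; case: (x < y).
have [xN|xN] := leqP x.+1 N.
  by rewrite big_nat_recr //= IH; lia.
by rewrite big_geq //; lia.
Qed.

Lemma crowd_upd a i v x : proper a -> 0 < a i -> jump a i v -> 0 < x ->
  crowd (upd a i v) x + (x < a i) = crowd a x + (x < v).
Proof.
move=> pa a0 jv x0; rewrite /crowd.
have E y : y < n.+2 -> (x < y) = (x < y < n.+2) by move=> ->; rewrite andbT.
rewrite [X in _ + nat_of_bool X = _]E // [X in _ = _ + nat_of_bool X]E //.
rewrite -!sum_eq_nat -!big_split /= big_nat_cond [RHS]big_nat_cond.
by apply: eq_bigr => y; rewrite andbT => /andP[xy _]; apply: occupied_upd => //; lia.
Qed.

(** Compare the crowds above [y.-1]: from [y] to [x] all [x.+1 - y] levels are occupied in [a], but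
    at most [x - y] in [b], so [b] has to make up for it above [x]. *)
Lemma crowd_gap a b x y : (forall z, 0 < z -> crowd a z <= crowd b z) ->
  1 < y <= x -> x < n.+2 -> (forall z, y <= z <= x -> occupied a z) ->
  ~~ occupied b y -> crowd a x < crowd b x.
Proof.
move=> ab /andP[y1 yx] xn full gap.
have := ab y.-1; rewrite /crowd prednK; last by lia.
rewrite !(@big_cat_nat _ _ _ x.+1 y n.+2) //=; try lia.
rewrite [X in _ <= X + _](@big_ltn _ _ _ y); last by lia.
rewrite (negPf gap) add0n.
have -> : \sum_(y <= i < x.+1) occupied a i = x.+1 - y.
  rewrite -[RHS]muln1 -[RHS]sum_nat_const_nat big_nat_cond [RHS]big_nat_cond.
  by apply: eq_bigr => z; rewrite andbT => /andP[yz zx]; rewrite full // yz.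
have : \sum_(y.+1 <= i < x.+1) occupied b i <= x - y.
  rewrite -[x - y]muln1 -subSS -sum_nat_const_nat.
  by apply: leq_sum => z _; case: occupied.
have := ab y.-1; lia.
Qed.

Lemma move_dom_eq i a v : jump a i v -> dom (move i a) = dom a.
Proof.
move=> jv; rewrite /move; case: eqP => // /eqP ai.
rewrite /next_hole; case: pickP => [w /andP[/andP[_ aw] _]|none] /=.
  apply/setP => k; rewrite !inE ffunE; have [->|//] := eqVneq k i.
  by move: ai; rewrite -val_eqE /=; lia.
case: (arg_minnP (fun w : 'I_n.+2 => w : nat) jv) => w jw mw.
have := none w; rewrite jw; case/negbT/forallPn => u.
by rewrite negb_imply => /andP[/mw ->].
Qed.

Lemma hybrid_step a c i : hybrid a c i.+1 = upd (hybrid a c i) i (c i).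
Proof.
apply/ffunP => k; rewrite !ffunE ltnS; have [->|ki] := eqVneq k i.
  by rewrite leqnn.
by rewrite leq_eqVlt (_ : (k == i :> nat) = false) //; apply/eqP => /val_inj/eqP; apply/negP.
Qed.

Lemma dance_jump theta a c i : dance theta a c -> 0 < a i -> theta < a i ->
  jump (hybrid a c i) i (c i).
Proof.
case=> mv pr a0 ai; have := mv i; rewrite ai => ac.
rewrite /jump ffunE ltnn ac andbT; apply/forallP => k; apply/eqP => E.
have [ki|ki] := eqVneq k i.
  by move: E; rewrite ki ffunE ltnn => E; rewrite E ltnn in ac.
have /properP/(_ _ _ ki) := pr i.+1.
by rewrite hybrid_step !ffunE eqxx (negPf ki); move: E; rewrite ffunE => -> /(_ erefl); lia.
Qed.

(* If any dance can be completed, so can the greedy one: above every level it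
   occupies at most as many holes. *)
Lemma greedy_invariant a c t : dance 0 a c -> t <= m.+1 ->
  [/\ dom (run a t) = dom a, forall i, t <= i -> run a t i = a i,
      proper (run a t)
    & forall x, 0 < x -> crowd (run a t) x <= crowd (hybrid a c t) x].
Proof.
move=> da; have [mv pr] := da.
have h0 : hybrid a c 0 = a by apply/ffunP => i; rewrite ffunE.
elim: t => [|t IH] tm; first by rewrite h0; split=> //; rewrite /= -h0.
have {IH} [ds sa ps cr] := IH (ltnW tm).
have [i it] : exists i : 'I_m.+1, i = t :> nat by exists (Ordinal tm).
rewrite -it hybrid_step; rewrite -it in ds sa ps cr {tm}.
rewrite /= inord_val; move: (run a i) ds sa ps cr => s ds sa ps cr.
have sai : s i = a i by apply: sa.
have [idom|iN] := boolP (i \in dom s); last first.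
  rewrite move_notin //; split => // [k ik|x x0]; first by rewrite sa // ltnW.
  suff -> : c i = hybrid a c i i by rewrite upd_same; apply: cr.
  rewrite ffunE ltnn; have := mv i.
  by move: iN; rewrite inE sai => /negPf ->; move/eqP.
have a0 : 0 < a i by move: idom; rewrite inE sai.
have jH := dance_jump da a0 a0; have := mv i; rewrite a0 => ac.
have gap : ~~ occupied (hybrid a c i) (c i).
  by apply/existsPn => k; have /andP[/forallP/(_ k) + _] := jH; rewrite -val_eqE.
have c1 : 1 < c i by lia.
(* Were all holes above [a i] taken, [crowd_gap] at the top level would give a strict inequality
   between two empty sums. *)
have [w jw] : exists w, jump s i w.
  have [/existsP[w jw]|/existsPn none] := boolP [exists w, jump s i w]; first by exists w.
  suff : crowd s n.+1 < crowd (hybrid a c i) n.+1 by rewrite /crowd !big_geq.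
  apply: (crowd_gap cr) gap => //; first by rewrite c1 -ltnS ltn_ord.
  move=> z /andP[cz zn]; have := none (inord z).
  rewrite negb_and => /orP[/forallPn[k]|].
    by rewrite negbK => /eqP E; apply/existsP; exists k; rewrite E inordK.
  by rewrite sai inordK //; lia.
have dm := move_dom_eq jw.
have [v [-> jv minv]] := moveP idom dm; have [va av] := andP jv.
have pv := upd_proper i ps va.
have s0 : 0 < s i by rewrite sai.
split=> //.
- rewrite -ds; apply/setP => k; rewrite !inE ffunE; have [->|//] := eqVneq k i; lia.
- move=> k ik; rewrite ffunE ifN; first by apply: sa; apply: ltnW.
  by rewrite -val_eqE /=; lia.
move=> x x0.
have h0' : 0 < hybrid a c i i by rewrite ffunE ltnn.
have := crowd_upd ps s0 jv x0; have := crowd_upd (pr i) h0' jH x0.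
rewrite sai ffunE ltnn; have := cr x x0.
(* The greedy crowd can gain on the other one only for [c i <= x < v]. There, [v] being least, the
   greedy position fills all levels from [c i] to [x], and [crowd_gap] supplies the missing unit. *)
have [xv|] := ltnP x v; last lia.
have [|cx] := ltnP x (c i); first lia.
have : crowd s x < crowd (hybrid a c i) x.
  apply: (@crowd_gap _ _ _ (c i)) => //; first by rewrite c1.
    exact: leq_trans xv (ltnW (ltn_ord _)).
  move=> z /andP[cz zx]; apply: contraT => free.
  have zn : z < n.+2 by apply: leq_ltn_trans zx _; apply: ltn_trans xv _.
  have : jump s i (inord z).
    rewrite /jump sai inordK //; apply/andP; split; last lia.
    apply/forallP => k; apply: contra free => /eqP E.
    by apply/existsP; exists k; rewrite E inordK.
  by move/minv; rewrite inordK //; lia.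
lia.
Qed.

Lemma dance_danceable a c : dance 0 a c -> danceable a.
Proof.
move=> da; have [ds _ _ _] := greedy_invariant da (leqnn _).
rewrite /danceable ds eqxx andbT; case: da => _ /(_ 0).
by rewrite (_ : hybrid a c 0 = a) //; apply/ffunP => i; rewrite ffunE.
Qed.
(* The pigeons at level 1 can be sent to holes that no other pigeon starts
   from or arrives at; this is where [d <= n/2] is needed. *)
Lemma dance_ground a c : dance 1 a c -> (#|dom a|).*2 <= n -> exists c', dance 0 a c'.
Proof.
case=> mv pr small.
pose N := [set i | 1 < a i]; pose Z := [set i | a i == 1 :> nat].
pose busy := [set v : 'I_n.+2 | v <= 1] :|: a @: N :|: c @: N.
(* At most [2 + 2 * #|N|] of the [n.+2] levels are busy, while [#|N| + #|Z|] is at most n/2. *)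
have room : #|Z| <= #|~: busy|.
  have : #|busy| <= 2 + #|N| + #|N|.
    rewrite (leq_trans (leq_card_setU _ _)) // leq_add ?leq_imset_card //.
    rewrite (leq_trans (leq_card_setU _ _)) // leq_add ?leq_imset_card //.
    have : [set v : 'I_n.+2 | v <= 1] \subset [set inord 0; inord 1].
      apply/subsetP => v; rewrite !inE => v1.
      by rewrite -!val_eqE /= !inordK //; case: (nat_of_ord v) v1 => [|[]].
    by move/subset_leq_card/leq_trans; apply; rewrite cards2; case: eqP.
  have : #|N| + #|Z| = #|dom a|.
    have NZ : N :&: Z = set0 by apply/setP => i; rewrite !inE; lia.
    rewrite -cardsUI NZ cards0 addn0; congr #|pred_of_set _|.
    by apply/setP => i; rewrite !inE; lia.
  have := cardsC busy; rewrite card_ord; lia.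
pose ground i := nth ord0 (enum (~: busy)) (index i (enum Z)).
have groundP i : i \in Z -> ground i \notin busy.
  move=> iZ; rewrite -in_setC -mem_enum mem_nth // -cardE (leq_trans _ room) //.
  by rewrite cardE index_mem mem_enum.
have ground_inj i k : i \in Z -> k \in Z -> ground i = ground k -> i = k.
  move=> iZ kZ /eqP; rewrite nth_uniq ?enum_uniq //; last 2 first.
  - by rewrite -cardE (leq_trans _ room) // cardE index_mem mem_enum.
  - by rewrite -cardE (leq_trans _ room) // cardE index_mem mem_enum.
  move/eqP => E; have := congr1 (nth i (enum Z)) E.
  by rewrite !nth_index ?mem_enum.
pose c' : config := [ffun i => if a i == 1 :> nat then ground i else c i].
exists c'; split=> [i|t].
  rewrite ffunE; have [E|ai] := eqVneq (a i : nat) 1.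
    have := groundP i; rewrite !inE E !negb_or => /(_ (eqxx _)) /andP[/andP[g _] _].
    by move: g; rewrite -ltnNge.
  by have := mv i; case: (ltnP 1 (a i)) => ai1; case: (ltnP 0 (a i)) => ai0 //; lia.
have hyb i : a i != 1 :> nat -> hybrid a c' t i = hybrid a c t i.
  by move=> ai; rewrite !ffunE (negPf ai).
have busyP i : a i != 1 :> nat -> hybrid a c t i \in busy.
  move=> ai; rewrite ffunE !inE; have := mv i; case: ifP => [iN _|iN /eqP ->].
    by case: ifP => _; rewrite imset_f ?orbT // inE.
  by rewrite if_same; apply/orP; left; apply/orP; left; lia.
have key i k : i != k -> a i == 1 :> nat -> hybrid a c' t i = hybrid a c' t k ->
    hybrid a c' t i <= 1.
  move=> ik ai; have [it|ti] := ltnP i t; last first.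
    by rewrite [hybrid a c' t i]ffunE ltnNge ti /= (eqP ai).
  have Ei : hybrid a c' t i = ground i by rewrite !ffunE it ai.
  have iZ : i \in Z by rewrite inE.
  have [ak|ak] := eqVneq (a k : nat) 1; last first.
    by rewrite (hyb k) // Ei => E; have := groundP i iZ; rewrite E busyP.
  have [kt|tk] := ltnP k t; last first.
    by move=> ->; rewrite ffunE ltnNge tk /= ak.
  have -> : hybrid a c' t k = ground k by rewrite !ffunE kt ak.
  by rewrite Ei => /ground_inj E; move: ik; rewrite E ?eqxx // inE ak.
apply/properP => i k ik E.
have [ai|ai] := boolP (a i == 1 :> nat); first exact: key E.
have [ak|ak] := boolP (a k == 1 :> nat).
  by rewrite E; apply: key ak (esym E); rewrite eq_sym.
by move: E; rewrite !hyb //; apply/properP: ik.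
Qed.
End Dance.

Local Open Scope ring_scope.

(** * Functions on partial matchings *)

Section Functions.
Variables (F : fieldType) (m n : nat).
Implicit Types (a b c e h : config m n) (i k : 'I_m.+1) (v w : 'I_n.+2).

(** A partial matching in total form: the unmatched pigeons are at level 1. *)
Definition point h := proper h && [forall i, (0 < h i)%N].

Definition extends a h := [forall i, (a i == 0 :> nat) || (a i == h i)].

Local Notation funs := {ffun config m n -> F^o}.

Definition ind a : funs := [ffun h => (point h && extends a h)%:R].

Lemma ind_improper a : ~~ proper a -> ind a = 0.
Proof.
move=> npa; apply/ffunP => h; rewrite !ffunE.
case: andP => // -[/andP[/properP ph _] /forallP ah]; case/negP: npa.
apply/properP => i k ik E; rewrite leqNgt; apply/negP => ai1.
have hi : a i = h i by have /orP[/eqP E0|/eqP //] := ah i; rewrite E0 in ai1.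
have hk : a k = h k.
  by have /orP[/eqP E0|/eqP //] := ah k; rewrite E E0 in ai1.
by have := ph _ _ ik; rewrite -hi -hk -E => /(_ erefl); lia.
Qed.

Lemma extends_upd a h i v : (0 < v)%N -> extends (upd a i v) h =
  (v == h i) && extends (upd a i ord0) h.
Proof.
move=> v0; apply/forallP/andP => [H|[vh /forallP H] k].
  split; first by have := H i; rewrite ffunE eqxx; case/orP => // /eqP E; rewrite E in v0.
  by apply/forallP => k; have := H k; rewrite !ffunE; case: ifP.
by have := H k; rewrite !ffunE; have [->|//] := eqVneq k i; rewrite vh orbT.
Qed.

Lemma ind_expand a i : ind (upd a i ord0) = \sum_(v : 'I_n.+2 | (0 < v)%N) ind (upd a i v).
Proof.
apply/ffunP => h; rewrite sum_ffunE ffunE.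
have [ph|np] := boolP (point h); last first.
  by rewrite big1 // => v _; rewrite ffunE (negPf np).
have hi : (0 < h i)%N by have /andP[_ /forallP] := ph.
rewrite (bigD1 (h i)) //= big1 ?addr0.
  by rewrite ffunE ph (extends_upd _ _ _ hi) eqxx.
by move=> v /andP[v0 vh]; rewrite ffunE (extends_upd _ _ _ v0) (negPf vh) andbF.
Qed.

Lemma ind_exchange a i : (0 < a i)%N -> ind a = ind (upd a i ord0) -
  \sum_(v : 'I_n.+2 | (0 < v)%N && (v != a i)) ind (upd a i v).
Proof.
by move=> ai; rewrite ind_expand (bigD1 (a i)) //= upd_same addrK.
Qed.

(** The levels are digits in base [n.+2], the last pigeon being the most significant, so that a drop
    of one pigeon outweighs any rise of the pigeons before it. *)
Definition weight a := (\sum_(i < m.+1) a i * n.+2 ^ i)%N.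

Lemma sum_digits_lt (f : nat -> 'I_n.+2) t :
  (\sum_(i < t) f i * n.+2 ^ i < n.+2 ^ t)%N.
Proof.
elim: t => [|t IH]; first by rewrite big_ord0.
rewrite big_ord_recr /= expnS -[X in (X <= _)%N]addSn.
have := leq_mul (ltn_ord (f t)) (leqnn (n.+2 ^ t)); rewrite mulSn.
by apply: leq_trans; rewrite leq_add2r.
Qed.

Lemma weight_lt a b i : (forall k, (i < k)%N -> b k = a k) -> (b i < a i)%N ->
  (weight b < weight a)%N.
Proof.
move=> high low; pose dig (c : config m n) j := c (inord j).
have W c : weight c = (\sum_(0 <= j < m.+1) dig c j * n.+2 ^ j)%N.
  by rewrite big_mkord; apply: eq_bigr => k _; rewrite /dig inord_val.
rewrite !W !(@big_cat_nat _ _ _ i.+1 0 m.+1) //=.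
have -> : (\sum_(i.+1 <= j < m.+1) dig b j * n.+2 ^ j =
           \sum_(i.+1 <= j < m.+1) dig a j * n.+2 ^ j)%N.
  rewrite big_nat_cond [RHS]big_nat_cond; apply: eq_bigr => j; rewrite andbT => /andP[ij jm].
  by rewrite /dig high // inordK.
rewrite ltn_add2r !big_nat_recr //= /dig inord_val.
have := sum_digits_lt (dig b) i; rewrite big_mkord.
have := leq_mul low (leqnn (n.+2 ^ i)); rewrite mulSn /dig; lia.
Qed.

(** * Danceable bases and locality *)

Definition grounded a := [exists i, a i == 1 :> nat].

(** The flag lets one definition serve both for all functions of degree [d] ([z] false) and for I_d
    ([z] true). *)
Definition basis d (z : bool) :=
  [set b : config m n | [&& danceable b, (#|dom b| <= d)%N & z ==> grounded b]].

(* The space [I_d] of the header is [space d true]. *)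
Definition space d z : {vspace funs} := <<[seq ind b | b <- enum (basis d z)]>>%VS.

Lemma ind_space_danceable d z a : a \in basis d z -> ind a \in space d z.
Proof. by move=> ab; apply: memv_span; apply: map_f; rewrite mem_enum. Qed.

Lemma dom_upd a i v : (#|dom (upd a i v)| <= #|dom a|.+1)%N.
Proof.
have : dom (upd a i v) \subset i |: dom a.
  by apply/subsetP => k; rewrite !inE ffunE; case: eqP.
by move/subset_leq_card/leq_trans; apply; rewrite cardsU1; case: (_ \notin _).
Qed.

(* Sum out the pigeons one after the other: every term in which some pigeon
   goes down has a smaller weight, and the terms in which all pigeons have gone
   up would be dances from [a]. *)
Lemma ind_space d z a : (d.*2 <= n)%N -> (#|dom a| <= d)%N -> z ==> grounded a ->
  ind a \in space d z.
Proof.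
move=> dn; have [N] := ubnP (weight a); elim: N a => // N IH a; rewrite ltnS => wa ad ga.
have [pa|/ind_improper ->] := boolP (proper a); last exact: mem0v.
have [da|nda] := boolP (danceable a).
  by apply: ind_space_danceable; rewrite inE da ad.
(* Here [e] is the position after the first [t] pigeons have gone up from [a], those at levels 0 and
   1 staying put; [u] pigeons remain. *)
suff H u t e : (t + u = m.+1)%N ->
    (forall i, (i < t)%N -> if (1 < a i)%N then (a i < e i)%N else e i == a i) ->
    (forall i, (t <= i)%N -> e i = a i) -> (forall t', proper (hybrid a e t')) ->
    ind e \in space d z.
  apply: (H m.+1 0%N a) => // t'; rewrite (_ : hybrid a a t' = a) //.
  by apply/ffunP => i; rewrite ffunE if_same.
elim: u t e => [|u IHu] t e tu up same pr.
  (* No pigeon remains, so [e] completes a dance from [a], although [a] is not danceable. *)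
  have : dance 1 a e.
    by split=> // i; apply: up; rewrite -(addn0 t) tu.
  case/dance_ground; first by apply: leq_trans dn; rewrite leq_double.
  by move=> c /dance_danceable; rewrite (negPf nda).
have tm : (t < m.+1)%N by lia.
have [i it] : exists i : 'I_m.+1, i = t :> nat by exists (Ordinal tm).
have eai : e i = a i by apply: same; rewrite it.
have [ai|ai] := leqP (a i) 1.
  apply: (IHu t.+1) => //; first by rewrite addSnnS.
    move=> k; rewrite ltnS leq_eqVlt => /orP[/eqP kt|]; last exact: up.
    have -> : k = i by apply: val_inj; rewrite /= kt it.
    by rewrite ltnNge ai eai eqxx.
  by move=> k tk; apply: same; apply: ltnW.
(* Later pigeons are still as in [a], so a drop at [i] lowers the weight. The value 0 covers the
   term in which [i] is no longer mentioned. *)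
have small v : (v < a i)%N -> ind (upd e i v) \in space d z.
  move=> va; apply: IH.
  - apply: leq_trans wa; apply: (@weight_lt _ _ i); last by rewrite ffunE eqxx.
    by move=> k ik; rewrite ffunE ifN ?same // -?val_eqE /=; lia.
  - apply: leq_trans ad; apply: subset_leq_card; apply/subsetP => k.
    rewrite !inE ffunE; have [-> _|_] := eqVneq k i; first lia.
    have [kt|tk] := ltnP k t; last by rewrite same.
    by have := up k kt; case: ifP => [? _ _|_ /eqP -> //]; lia.
  - apply/implyP => zz; move: ga; rewrite zz /= => /existsP[k /eqP ak].
    apply/existsP; exists k; rewrite ffunE ifN.
      have [kt|tk] := ltnP k t; last by rewrite same // ak.
      by have := up k kt; rewrite ak /= => /eqP ->; rewrite ak.
    by apply/eqP => ki; rewrite -ki ak in ai.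
rewrite (@ind_exchange e i); last by rewrite eai ltnW.
rewrite rpredB ?small ?(ltnW ai) //; apply: rpred_sum => v /andP[v0 vi].
have [va|av] := ltnP v (a i); first exact: small.
have {}av : (a i < v)%N.
  by rewrite ltn_neqAle av andbT; move: vi; rewrite eai eq_sym.
have [pv|/ind_improper ->] := boolP (proper (upd e i v)); last exact: mem0v.
apply: (IHu t.+1) => //; first by rewrite addSnnS.
- move=> k; rewrite ltnS leq_eqVlt ffunE => /orP[/eqP kt|kt].
    have -> : k = i by apply: val_inj; rewrite /= kt it.
    by rewrite eqxx ai.
  have -> : (k == i) = false by rewrite -val_eqE /=; lia.
  exact: up.
- by move=> k tk; rewrite ffunE ifN ?same ?(ltnW tk) // -val_eqE /=; lia.
move=> t'; have [t'i|it'] := leqP t' i.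
  rewrite (_ : hybrid _ _ _ = hybrid a e t') //; apply/ffunP => k; rewrite !ffunE.
  by case: ifP => // kt; rewrite ifN // -val_eqE /=; lia.
rewrite (_ : hybrid _ _ _ = upd e i v) //; apply/ffunP => k; rewrite !ffunE.
by case: ifP => // kt; rewrite ifN ?same // -?val_eqE /=; lia.
Qed.

Definition holes_only d :=
  [set b : config m n | [&& proper b, (#|dom b| <= d)%N & ~~ grounded b]].

(** Leaving all further pigeons unmatched completes [b] in such a way that the only ungrounded
    configurations it extends are parts of [b]. *)
Lemma extends_dom b c : ~~ grounded c ->
  extends c [ffun i => if b i == 0 :> nat then inord 1 else b i] ->
  dom c \subset dom b /\ {in dom c, c =1 b}.
Proof.
move=> /existsPn gc /forallP cb.
have key i : i \in dom c -> (0 < b i)%N /\ c i = b i.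
  rewrite inE => c0; have /orP[/eqP E|/eqP E] := cb i; first by rewrite E in c0.
  move: E; rewrite ffunE; case: ifP => [_ E|b0 ->]; last by rewrite lt0n b0.
  by have := gc i; rewrite E inordK.
by split=> [|i /key[]//]; apply/subsetP => i /key[]; rewrite inE.
Qed.

(** Evaluate a vanishing combination at the completion [h] of [b]. Only parts of [b] contribute, and
    by induction on the size of the domain the smaller ones already have coefficient 0. *)
Lemma free_holes_only d : free [seq ind b | b <- enum (holes_only d)].
Proof.
pose X : #|holes_only d|.-tuple funs := map_tuple ind (enum_tuple (holes_only d)).
suff : free X by [].
apply/freeP => k Xk i.
have Xi (j : 'I_#|holes_only d|) : X`_j = ind (enum_val j).
  by rewrite (nth_map (enum_val j)) -?cardE // -enum_val_nth.
have [N] := ubnP #|dom (enum_val i)|; elim: N i => // N IH i; rewrite ltnS => iN.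
pose b := enum_val i.
pose h : config m n := [ffun i => if b i == 0 :> nat then inord 1 else b i].
have bM (j : 'I_#|holes_only d|) : proper (enum_val j) /\ ~~ grounded (enum_val j).
  by have := enum_valP j; rewrite inE => /and3P[].
have ph : point h.
  apply/andP; split; last first.
    by apply/forallP => j; rewrite ffunE; case: ifP => [_|b0]; rewrite ?inordK // lt0n b0.
  have [/properP pb _] := bM i; apply/properP => j l jl; rewrite !ffunE.
  case: ifP => [_ _|bj]; first by rewrite inordK.
  by case: ifP => [_ ->|_ /pb ->]; rewrite ?inordK.
have : (\sum_j k j *: X`_j) h = 0 by rewrite Xk ffunE.
rewrite sum_ffunE (bigD1 i) //= big1 ?addr0.
  have ext : extends (enum_val i) h by apply/forallP => j; rewrite ffunE -/b; have [//|] := eqVneq (b j : nat) 0%N; rewrite eqxx.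
  by rewrite Xi !ffunE ph ext [_ *: _]mulr1.
move=> j ji; rewrite Xi !ffunE ph /=; case: (boolP (extends _ _)) => [ext|_]; last first.
  by rewrite scaler0.
have [sub agree] := extends_dom (bM j).2 ext.
rewrite IH ?scale0r //; apply: leq_trans iN; apply: proper_card.
rewrite properEneq sub andbT; apply/eqP => E; case/eqP: ji; apply: enum_val_inj.
apply/ffunP => l; have [|lN] := boolP (l \in dom (enum_val j)); first exact: agree.
have lN' : l \notin dom b by rewrite -E.
by apply: val_inj => /=; move: lN lN'; rewrite !inE -!eqn0Ngt => /eqP -> /eqP ->.
Qed.

Lemma card_basis d : (#|basis d false| <= #|holes_only d|)%N.
Proof.
have inj : {in basis d false &, injective (fun a => run a m.+1)}.
  by move=> a b; rewrite !inE => /andP[da _] /andP[db _]; apply: run_inj.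
rewrite -(card_in_imset inj); apply: subset_leq_card.
apply/subsetP => _ /imsetP[a + ->]; rewrite !inE => /and3P[da ad _].
rewrite danceable_proper // danceable_dom // ad !andTb.
by apply/existsPn => i; apply: run_holes.
Qed.

(* The functions in [holes_only d] are monomials, hence independent; the basis
   spans them and is not larger, as the greedy dance is injective. *)
Lemma free_basis d : (d.*2 <= n)%N -> free [seq ind b | b <- enum (basis d false)].
Proof.
move=> dn; rewrite /free eqn_leq dim_span size_map -cardE /=.
apply: leq_trans (card_basis d) _; have := free_holes_only d.
rewrite /free size_map -cardE => /eqP <-; apply: dimvS; apply/span_subvP => x.
case/mapP => b; rewrite mem_enum inE => /and3P[_ bd _] ->.
exact: ind_space.
Qed.

(** A complement of I_d among the functions of degree [d], spanned by the rest of the same basis so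
    that it grows with [d]. *)
Definition hole_space d : {vspace funs} :=
  <<[seq ind b | b <- enum (basis d false :\: basis d true)%SET]>>%VS.

Lemma hole_space_cap d : (d.*2 <= n)%N -> (hole_space d :&: space d true = 0)%VS.
Proof.
move=> /free_basis; have P : perm_eq (enum (basis d false))
    (enum (basis d false :\: basis d true) ++ enum (basis d true)).
  apply: uniq_perm; rewrite ?enum_uniq // ?cat_uniq ?enum_uniq ?andbT /=.
    by apply/hasPn => b; rewrite !mem_enum in_setD => ->.
  move=> b; rewrite mem_cat !mem_enum !inE.
  by case: danceable; case: (_ <= _)%N; case: grounded.
rewrite (perm_free (perm_map _ P)) map_cat cat_free => /and3P[_ _].
by move/directv_addP.
Qed.

Lemma space_split d : (space d false <= hole_space d + space d true)%VS.
Proof.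
apply/span_subvP => x /mapP[b]; rewrite mem_enum => bd ->.
have [bt|bt] := boolP (b \in basis d true).
  by apply: (subvP (addvSr _ _)); apply: ind_space_danceable.
apply: (subvP (addvSl _ _)); apply: memv_span; apply: map_f.
by rewrite mem_enum inE bt bd.
Qed.

Lemma spaceS d d' (z z' : bool) p : (d <= d')%N -> z' ==> z ->
  p \in space d z -> p \in space d' z'.
Proof.
move=> dd zz; move: p; apply/subvP; apply/span_subvP => x /mapP[b]; rewrite mem_enum inE => /and3P[db bd bz] ->.
apply: ind_space_danceable; rewrite inE db (leq_trans bd dd) /=.
by case: z' zz => //= zt; move: bz; rewrite zt.
Qed.

Lemma hole_spaceS d d' : (d <= d')%N -> (hole_space d <= hole_space d')%VS.
Proof.
move=> dd; apply/span_subvP => x /mapP[b]; rewrite mem_enum !inE /= => /and3P[bt db bd] ->.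
apply: memv_span; apply: map_f; rewrite mem_enum !inE /= db /=.
by move: bt; rewrite db (andP bd).1 (leq_trans (andP bd).1 dd) /= => ->.
Qed.

(** Split [p] at degree [d] into [q] in the complement and [r] in I_d. Then [q] lies both in I_d'
    and in the complement at degree [d'], so it vanishes. *)
Lemma space_local d d' p : (d <= d')%N -> (d'.*2 <= n)%N ->
  p \in space d false -> p \in space d' true -> p \in space d true.
Proof.
move=> dd dn /(subvP (space_split d)) /memv_addP[q qd [r rd ->]] prd.
suff -> : q = 0 by rewrite add0r.
apply/eqP; rewrite -memv0 -(hole_space_cap dn) memv_cap (subvP (hole_spaceS dd) _ qd) /=.
by rewrite -[q](addrK r) rpredB // (@spaceS _ _ true true _ dd isT rd).
Qed.

Definition one : funs := [ffun h => (point h)%:R].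

Lemma one_ind : one = ind [ffun=> ord0].
Proof.
apply/ffunP => h; rewrite !ffunE; congr (nat_of_bool _)%:R.
by rewrite [X in _ && X](_ : _ = true) ?andbT //; apply/forallP => i; rewrite ffunE.
Qed.

Lemma one_space : one \in space 0 false.
Proof.
rewrite one_ind; apply: ind_space => //; rewrite leqn0 cards_eq0.
by apply/eqP/setP => i; rewrite !inE ffunE.
Qed.

(** By locality it would already be in I_0, which is zero because a grounded configuration mentions
    some pigeon. *)
Lemma one_notin d : (d.*2 <= n)%N -> one \notin space d true.
Proof.
move=> dn; apply/negP => /(space_local (leq0n d) dn one_space).
rewrite (_ : space 0 true = 0%VS) ?memv0.
  pose h : config m n := [ffun=> inord 1].
  move/eqP/ffunP/(_ h); rewrite !ffunE => /eqP; rewrite (_ : point h) ?oner_eq0 //.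
  apply/andP; split; last by apply/forallP => i; rewrite ffunE inordK.
  by apply/properP => i k _; rewrite !ffunE inordK.
apply/eqP; rewrite -subv0; apply/span_subvP => x /mapP[b].
rewrite mem_enum !inE leqn0 cards_eq0 => /and3P[_ /eqP b0 /existsP[i /eqP bi]].
by have := in_set0 i; rewrite -b0 inE bi.
Qed.

(** * Multiplication by variables *)

Definition mulf (f g : config m n -> F) : funs := [ffun h => f h * g h].

Definition at_value i v : funs := [ffun h : config m n => (h i == v)%:R].

Lemma span_ind (vT : vectType F) (X : seq vT) (P : vT -> Prop) :
  P 0 -> (forall s x y, P x -> P y -> P (s *: x + y)) ->
  (forall x, x \in X -> P x) -> forall x, x \in <<X>>%VS -> P x.
Proof.
move=> P0 Plin PX x /(@coord_span _ _ _ (in_tuple X)) ->.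
elim/big_rec: _ => // i y _ Py; apply: Plin => //.
by apply: PX; apply: mem_nth.
Qed.

Lemma mulf_space (f : funs) d z (U : {vspace funs}) p :
  (forall b, b \in basis d z -> mulf f (ind b) \in U) ->
  p \in space d z -> mulf f p \in U.
Proof.
move=> fU; rewrite /space; move: p; refine (@span_ind _ _ (fun p : funs => mulf f p \in U) _ _ _) => [|s x y xU yU|x /mapP[b]]; last first.
- by rewrite mem_enum => bd ->; apply: fU.
- rewrite (_ : mulf f _ = s *: mulf f x + mulf f y) ?rpredD ?rpredZ //.
  by apply/ffunP => h; rewrite !ffunE mulrDr; congr (_ + _); rewrite [LHS]mulrCA.
- rewrite (_ : mulf f (0 : funs) = 0) ?mem0v //.
  by apply/ffunP => h; rewrite !ffunE mulr0.
Qed.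

Lemma at_value_ind i v b : (0 < v)%N -> mulf (at_value i v) (ind b) =
  if b i == 0 :> nat then ind (upd b i v) else if b i == v then ind b else 0.
Proof.
move=> v0; apply/ffunP => h; rewrite !ffunE -natrM mulnb.
have [bi|bi] := eqVneq (b i : nat) 0%N.
  have bu : upd b i ord0 = b.
    by rewrite -[RHS](@upd_same _ _ b i); congr upd; apply: val_inj.
  by rewrite ffunE extends_upd // bu eq_sym andbCA.
have E : extends b h -> b i = h i by move/forallP/(_ i); rewrite (negPf bi) => /eqP.
have [bv|bv] := eqVneq (b i) v; rewrite !ffunE.
  case: (boolP (extends b h)) => [/E <-|_]; last by rewrite !andbF.
  by rewrite bv eqxx.
case: (boolP (extends b h)) => [/E <-|_]; last by rewrite !andbF.
by rewrite (negPf bv).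
Qed.

Lemma at_value_space i v d z p : (0 < v)%N -> (d.+1.*2 <= n)%N ->
  p \in space d z -> mulf (at_value i v) p \in space d.+1 z.
Proof.
move=> v0 dn; apply: mulf_space => b; rewrite inE => /and3P[_ bd bz].
rewrite at_value_ind //; case: eqP => [bi|_].
  apply: ind_space => //; first by rewrite (leq_trans (dom_upd _ _ _)).
  apply/implyP => zz; move: bz; rewrite zz => /existsP[k bk].
  by apply/existsP; exists k; rewrite ffunE ifN //; apply/eqP => ki; rewrite ki bi in bk.
case: eqP => _; last exact: mem0v.
by apply: ind_space => //; apply: leq_trans bd _.
Qed.

(** Requiring pigeon [i] to be unmatched grounds or kills every generator; this is the pigeon axiom
    in polynomial form. *)
Lemma at_ground_space i v d p : v = 1 :> nat -> (d.+1.*2 <= n)%N ->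
  p \in space d false -> mulf (at_value i v) p \in space d.+1 true.
Proof.
move=> v1 dn; apply: mulf_space => b; rewrite inE => /and3P[_ bd _].
rewrite at_value_ind ?v1 //; case: eqP => [bi|_].
  apply: ind_space => //; first by rewrite (leq_trans (dom_upd _ _ _)).
  by apply/existsP; exists i; rewrite ffunE eqxx v1.
case: eqP => bi; last exact: mem0v.
apply: ind_space => //; first by apply: leq_trans bd _.
by apply/existsP; exists i; rewrite bi v1.
Qed.
End Functions.

(** * Configurations of bounded space *)

Lemma F2_neq (a b : 'F_2) : (a != b) = (a == b + 1).
Proof. by case: a b => [[|[|//]] ?] [[|[|//]] ?]. Qed.

(** Over F_2 the indicator of a linear equation is itself affine, hence of degree one. *)
Lemma F2_eqN (a b : 'F_2) : (a == b)%:R = 1 + b + a.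
Proof. by case: a b => [[|[|//]] ?] [[|[|//]] ?]; apply: val_inj. Qed.

(** * Linear equations that force clauses *)

Section Equations.
Variable V : finType.
Implicit Types (x y : {ffun V -> 'F_2}) (e : lineq V) (C D : linclause V).

Definition holds e x := linform_eval e.1 x == e.2.

Definition forces e C := [forall x, holds e x ==> linsat x C].

Lemma eval_addl (f g : linform V) x :
  linform_eval (f + g) x = linform_eval f x + linform_eval g x.
Proof.
by rewrite /linform_eval -big_split; apply: eq_bigr => v _; rewrite ffunE mulrDl.
Qed.

Lemma eval_addr (f : linform V) x y :
  linform_eval f (x + y) = linform_eval f x + linform_eval f y.
Proof.
by rewrite /linform_eval -big_split; apply: eq_bigr => v _; rewrite ffunE mulrDr.
Qed.

Lemma eval_var (u : V) x : linform_eval (linform_var u) x = x u.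
Proof.
rewrite /linform_eval (bigD1 u) //= big1 ?addr0; first by rewrite ffunE eqxx mul1r.
by move=> w /negPf wu; rewrite ffunE wu mul0r.
Qed.

(** The falsifying assignments form an affine space, which is closed under sums of three. *)
Lemma holds_add3 e x y z : ~~ holds e x -> ~~ holds e y -> ~~ holds e z ->
  ~~ holds e (x + y + z).
Proof.
rewrite /holds !eval_addr !F2_neq => /eqP -> /eqP -> /eqP ->.
by case: e => f [[|[|//]] ?].
Qed.

Lemma linsatPn x C : reflect {in C, forall e, ~~ holds e x} (~~ linsat x C).
Proof. by rewrite negb_exists_in; apply: (iffP forall_inP). Qed.

Lemma linsatU x C D : linsat x (C :|: D) = linsat x C || linsat x D.
Proof.
apply/exists_inP/orP => [[e]|[] /exists_inP[e eC xe]].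
- by rewrite inE => /orP[] eC xe; [left|right]; apply/exists_inP; exists e.
- by exists e => //; rewrite inE eC.
- by exists e => //; rewrite inE eC orbT.
Qed.

Lemma linsat1 x e : linsat x [set e] = holds e x.
Proof.
apply/exists_inP/idP => [[e']|xe]; first by rewrite inE => /eqP ->.
by exists e; rewrite ?inE.
Qed.

Lemma forcesPn e C : ~~ forces e C -> exists2 x, holds e x & ~~ linsat x C.
Proof.
by move/forallPn => [x]; rewrite negb_imply => /andP[xe xC]; exists x.
Qed.

(* If neither [e1] nor [e2] nor their sum forces the resolvent, take witnesses
   [x], [y], [z]: then [x + y + z] satisfies both premises but falsifies
   [A :|: B], although it cannot satisfy both [f = 0] and [f = 1]. *)
Lemma resolvent_forced (f : linform V) (A B : linclause V) e1 e2 :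
  forces e1 ((f, 0) |: A) -> forces e2 ((f, 1) |: B) ->
  exists2 e, forces e (A :|: B) & forall x, holds e1 x -> holds e2 x -> holds e x.
Proof.
move=> /forallP F1 /forallP F2.
have P1 x : holds e1 x -> ~~ linsat x (A :|: B) -> holds (f, 0) x.
  move=> h; have := F1 x; rewrite h !linsatU linsat1 negb_or /=.
  by move=> /orP[//|xA] /andP[/negPf]; rewrite xA.
have P2 x : holds e2 x -> ~~ linsat x (A :|: B) -> holds (f, 1) x.
  move=> h; have := F2 x; rewrite h !linsatU linsat1 negb_or /=.
  by move=> /orP[//|xB] /andP[_ /negPf]; rewrite xB.
have P12 x : holds e1 x -> holds e2 x -> linsat x (A :|: B).
  move=> h1 h2; apply: contraT => xAB.
  by have := P1 x h1 xAB; have := P2 x h2 xAB; rewrite /holds /= => /eqP ->.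
pose e3 : lineq V := (e1.1 + e2.1, e1.2 + e2.2).
have e3P x : holds e3 x = (holds e1 x == holds e2 x).
  rewrite /holds eval_addl /=; move: (linform_eval _ _) (linform_eval _ _) => a b.
  by case: e1.2 e2.2 a b => [[|[|//]] ?] [[|[|//]] ?] [[|[|//]] ?] [[|[|//]] ?].
have [f1|/forcesPn[x x1 xn]] := boolP (forces e1 (A :|: B)); first by exists e1.
have [f2|/forcesPn[y y2 yn]] := boolP (forces e2 (A :|: B)); first by exists e2.
have [f3|/forcesPn[z z3 zn]] := boolP (forces e3 (A :|: B)).
  by exists e3 => // w w1 w2; rewrite e3P w1 w2.
have x2 : ~~ holds e2 x by apply: contra xn; apply: P12.
have y1 : ~~ holds e1 y by apply: contra yn => y1; apply: P12.
have z1 : ~~ holds e1 z.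
  by apply: contra zn => z1; apply: P12 => //; move: z3; rewrite e3P z1 => /eqP <-.
have z2 : ~~ holds e2 z by move: z3; rewrite e3P (negPf z1) => /eqP <-.
have two e : holds e x -> ~~ holds e y -> ~~ holds e z -> holds e (x + y + z).
  rewrite /holds !eval_addr !F2_neq => /eqP -> /eqP -> /eqP ->.
  by case: e => g [[|[|//]] ?].
have wn : ~~ linsat (x + y + z) (A :|: B).
  by apply/linsatPn => e eAB; apply: holds_add3; [move: xn|move: yn|move: zn];
    move/linsatPn; apply.
suff : linsat (x + y + z) (A :|: B) by rewrite (negPf wn).
apply: P12; first exact: two.
rewrite (addrC x y).
move: y2 x2 z2; rewrite /holds !eval_addr !F2_neq => /eqP -> /eqP -> /eqP ->.
by case: e2.2 => [[|[|//]] ?].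
Qed.

Lemma derivable_forced (S : configuration V) D (g : linclause V -> lineq V) :
  {in S, forall C, forces (g C) C} -> derivable S D ->
  exists2 e, forces e D & forall x, {in S, forall C, holds (g C) x} -> holds e x.
Proof.
move=> gS [f A B AS BS|C {}D CS CD].
  have [e eAB he] := resolvent_forced (gS _ AS) (gS _ BS).
  by exists e => // x xS; apply: he; apply: xS.
exists (g C) => [|x]; last exact.
apply/forallP => x; apply/implyP => xC; apply: CD.
by have /forallP/(_ x)/implyP := gS _ CS; apply.
Qed.

End Equations.

(** * Keeping a configuration alive *)

Section Game.
Variable n : nat.
Implicit Types (h : config n n) (S : configuration (pvar n)).
Implicit Types (C : linclause (pvar n)) (e : lineq (pvar n)).
Implicit Types (g : linclause (pvar n) -> lineq (pvar n)).

Local Notation funs := {ffun config n n -> ('F_2)^o}.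
Local Notation space := (@space 'F_2 n n).

(** The two lifts skip levels 0 and 1. *)
Definition hole (j : 'I_n) : 'I_n.+2 := lift ord0 (lift ord0 j).

Definition assignment h : {ffun pvar n -> 'F_2} :=
  [ffun p => (h p.1 == hole p.2)%:R].

Definition eqn_ind e : funs := [ffun h => (holds e (assignment h))%:R].

Definition conf_ind g S : funs :=
  [ffun h => (point h && [forall C in S, holds (g C) (assignment h)])%:R].

(** The indicator of an equation is an affine combination of variables, each reading one pigeon, so
    the degree rises by one however many variables occur. *)
Lemma eqn_ind_space e d z p : (d.+1.*2 <= n)%N -> p \in space d z ->
  mulf (eqn_ind e) p \in space d.+1 z.
Proof.
move=> dn pd; have -> : mulf (eqn_ind e) p = (1 + e.2) *: p +
    \sum_u e.1 u *: mulf (at_value 'F_2 u.1 (hole u.2)) p.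
  apply/ffunP => h; rewrite !ffunE sum_ffunE F2_eqN mulrDl; congr (_ + _).
  rewrite /linform_eval mulr_suml; apply: eq_bigr => u _.
  by rewrite !ffunE -mulrA.
rewrite rpredD ?rpredZ //; first by apply: spaceS pd => //; case: z.
by apply: rpred_sum => u _; rewrite rpredZ // at_value_space.
Qed.

Lemma conf_indU g C S : conf_ind g (C |: S) = mulf (eqn_ind (g C)) (conf_ind g S).
Proof.
apply/ffunP => h; rewrite !ffunE -natrM mulnb andbCA; congr (_ && _)%:R.
apply/forall_inP/andP => [H|[hC /forall_inP hS] D]; last first.
  by rewrite !inE => /orP[/eqP ->|/hS].
split; first by apply: H; rewrite setU11.
by apply/forall_inP => D DS; apply: H; rewrite inE DS orbT.
Qed.

Lemma conf_ind0 g : conf_ind g set0 = @one 'F_2 n n.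
Proof.
apply/ffunP => h; rewrite !ffunE [X in _ && X](_ : _ = true) ?andbT //.
by apply/forall_inP => C; rewrite inE.
Qed.

Lemma conf_ind_space g S : (#|S|.*2 <= n)%N -> conf_ind g S \in space #|S| false.
Proof.
move E : #|S| => s; elim: s S E => [|s IH] S E sn.
  by rewrite (cards0_eq E) conf_ind0 one_space.
have [C CS] : exists C, C \in S by apply/card_gt0P; rewrite E.
have := cardsD1 C S; rewrite CS E => -[Es].
rewrite -(setD1K CS) conf_indU; apply: eqn_ind_space => //.
by apply: IH => //; apply: leq_trans sn; rewrite leq_double.
Qed.

Definition alive d g S :=
  {in S, forall C, forces (g C) C} /\ conf_ind g S \notin space d true.

Lemma alive_add d g S C e : alive d g S -> forces e C ->
  mulf (eqn_ind e) (conf_ind g S) \notin space d true ->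
  exists g', alive d g' (C |: S).
Proof.
move=> [gS nS] eC ne; have [CS|CS] := boolP (C \in S).
  by exists g; rewrite (setUidPr _) ?sub1set.
pose g' D := if D == C then e else g D.
have g'S D : D \in S -> g' D = g D.
  by rewrite /g'; case: eqP => // ->; rewrite (negPf CS).
exists g'; split=> [D|].
  rewrite !inE /g'; case: eqP => [-> //|_] /=; exact: gS.
rewrite conf_indU /g' eqxx; suff -> : conf_ind g' S = conf_ind g S by [].
apply/ffunP => h; rewrite !ffunE; congr (_ && _)%:R.
by apply/eq_forallb => D; case: (boolP (D \in S)) => // /g'S ->.
Qed.

(** The new equation holds wherever the old ones do, so the indicator does not change. *)
Lemma alive_inference d g S C : alive d g S -> derivable S C ->
  exists g', alive d g' (C |: S).
Proof.
move=> al /(derivable_forced al.1)[e eC he]; apply: (alive_add al eC).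
rewrite (_ : mulf _ _ = conf_ind g S) ?al.2 //.
apply/ffunP => h; rewrite !ffunE; case: andP => [[_ /forall_inP hS]|]; last by rewrite mulr0.
by rewrite he // mulr1.
Qed.

(** If the smaller indicator were in I_d, locality would put it in degree [#|S| - 1]; multiplying by
    the erased equation would then put the old indicator in I_d. *)
Lemma alive_erasure d g S C : (#|S| <= d)%N -> (d.*2 <= n)%N ->
  alive d g S -> C \in S -> alive d g (S :\ C).
Proof.
move=> Sd dn [gS nS] CS; split=> [D|]; first by rewrite inE => /andP[_ /gS].
have Sn : (#|S|.*2 <= n)%N by apply: leq_trans dn; rewrite leq_double.
have E := cardsD1 C S; rewrite CS add1n in E.
apply: contra nS => H.
apply: (@spaceS _ _ _ _ _ true true _ Sd isT).
rewrite -{1}(setD1K CS) conf_indU E; apply: eqn_ind_space; first by rewrite -E.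
apply: space_local dn _ H; first by apply: leq_trans Sd; rewrite E.
by apply: conf_ind_space; apply: leq_trans Sn; rewrite leq_double E.
Qed.

(** Let c be the indicator of [S] and s its size. As [u] and [w] are never both true at a point, c =
    [w = 0] c + [w = 1] [u = 0] c. If neither equation can be attached, [w = 0] c and [u = 0] c are
    in I_d; locality puts the latter in I_(s+1), and the factor [w = 1] takes it to I_(s+2). Hence
    the slack of two. *)
Lemma alive_exclusion d g S C (u w : pvar n) : (#|S|.+2 <= d)%N -> (d.*2 <= n)%N ->
  (forall h, point h -> h u.1 = hole u.2 -> h w.1 = hole w.2 -> False) ->
  (linform_var u, 0) \in C -> (linform_var w, 0) \in C ->
  alive d g S -> exists g', alive d g' (C |: S).
Proof.
move=> Sd dn uw uC wC al.
have var_forces v : (linform_var v, 0) \in C -> forces (linform_var v, 0) C.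
  move=> vC; apply/forallP => x; apply/implyP => xv.
  by apply/exists_inP; exists (linform_var v, 0).
have [H1|] := boolP (mulf (eqn_ind (linform_var u, 0)) (conf_ind g S) \in space d true);
  last by apply: alive_add (var_forces _ uC).
have [H2|] := boolP (mulf (eqn_ind (linform_var w, 0)) (conf_ind g S) \in space d true);
  last by apply: alive_add (var_forces _ wC).
have Sn : (#|S|.*2 <= n)%N by lia.
have Sn1 : (#|S|.+1.*2 <= n)%N by lia.
have {}H1 := space_local (ltnW Sd) dn
  (eqn_ind_space (linform_var u, 0) Sn1 (conf_ind_space g Sn)) H1.
case: al => _ /negP[].
suff -> : conf_ind g S = mulf (eqn_ind (linform_var w, 0)) (conf_ind g S) +
   mulf (at_value 'F_2 w.1 (hole w.2)) (mulf (eqn_ind (linform_var u, 0)) (conf_ind g S)).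
  rewrite rpredD //; apply: (@spaceS _ _ _ _ _ true true _ Sd isT).
  by apply: at_value_space H1 => //; lia.
apply/ffunP => h; rewrite !ffunE /holds !eval_var !ffunE.
case: (boolP (point h)) => [ph|_]; last by rewrite !mulr0 addr0.
have := uw h ph; case: (h u.1 =P _) => [hu|_]; case: (h w.1 =P _) => [hw|_] //.
- by move/(_ hu hw).
- by rewrite mul0r addr0 mul1r.
- by rewrite mul0r add0r !mul1r.
- by rewrite mul0r addr0 mul1r.
Qed.

(** An odd sum forces some variable to be 1. At a point the sum is even only if [i] is unmatched,
    and that part of the indicator is in I_d by [at_ground_space]. *)
Lemma alive_pigeon d g S C i : (#|S|.+1 <= d)%N -> (d.*2 <= n)%N ->
  (forall j, (linform_var (i, j), 1) \in C) ->
  alive d g S -> exists g', alive d g' (C |: S).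
Proof.
move=> Sd dn iC al.
pose e : lineq (pvar n) := (\sum_j linform_var (i, j), 1).
have evalE x : linform_eval e.1 x = \sum_j x (i, j).
  rewrite /= (@big_morph _ _ (fun f => linform_eval f x) 0 +%R).
  - by apply: eq_bigr => j _; rewrite eval_var.
  - by move=> f f'; rewrite eval_addl.
  - by rewrite /linform_eval big1 // => u _; rewrite ffunE mul0r.
apply: (alive_add (e := e) al).
  apply/forallP => x; apply/implyP; rewrite /holds evalE => xe.
  apply: contraT => /linsatPn xC; move: xe; rewrite big1 // => j _.
  by have := xC _ (iC j); rewrite /holds eval_var F2_neq => /eqP ->; apply: val_inj.
have Sn : (#|S|.*2 <= n)%N by lia.
apply: contra al.2 => H.
have -> : conf_ind g S = mulf (eqn_ind e) (conf_ind g S) +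
    mulf (at_value 'F_2 i (inord 1)) (conf_ind g S).
  apply/ffunP => h; rewrite !ffunE; case: (boolP (point h)) => [ph|_]; last first.
    by rewrite !mulr0 addr0.
  rewrite -mulrDl -[LHS]mul1r; congr (_ * _).
  rewrite /holds evalE.
  have [hi|hi] := eqVneq (h i) (inord 1).
    rewrite big1 ?add0r // => j _; rewrite ffunE /= hi.
    by rewrite -val_eqE /= inordK.
  have h0 : (0 < h i)%N by have /andP[_ /forallP] := ph.
  have h1 : (h i != 1 :> nat) by move: hi; rewrite -val_eqE /= inordK.
  have hn : ((h i).-2 < n)%N by have := ltn_ord (h i); lia.
  have hj (j : 'I_n) : (h i == hole j) = (j == Ordinal hn).
    have E : (hole j : nat) = j.+2 by [].
    apply/eqP/eqP => [hj|->]; apply: val_inj; first by rewrite /= hj E.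
    by rewrite /= /bump /=; case: (nat_of_ord (h i)) h0 h1 => [|[]].
  rewrite (bigD1 (Ordinal hn)) //= big1 ?addr0 ?ffunE ?hj ?eqxx //=.
  by move=> j /negPf jn; rewrite ffunE hj jn.
rewrite rpredD //; apply: (@spaceS _ _ _ _ _ true true _ Sd isT).
by apply: at_ground_space; rewrite ?inordK ?conf_ind_space //; lia.
Qed.

Lemma lin_of_literal_in (D : clause (pvar n)) l :
  l \in D -> lin_of_literal l \in lin_of_clause D.
Proof. exact: imset_f. Qed.

Lemma hole_inj : injective hole.
Proof. by move=> j j' /lift_inj/lift_inj. Qed.

Lemma alive_download d g S C : (#|S|.+2 <= d)%N -> (d.*2 <= n)%N ->
  C \in lin_of_cnf (FPHP n) -> alive d g S -> exists g', alive d g' (C |: S).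
Proof.
move=> Sd dn /imsetP[D + ->]; rewrite !inE -orbA => /or3P[].
- case/imsetP => i _ -> al; apply: (alive_pigeon (i := i)) al => // [|j].
    exact: ltnW.
  have := @lin_of_literal_in _ ((i, j), true); apply.
  by apply/imsetP; exists j.
- case/bigcupP => j _ /imset2P[i i' _]; rewrite inE => /= ii' ->.
  apply: (alive_exclusion (u := (i, j)) (w := (i', j))) => //=.
  + move=> h /andP[/properP ph _] hi hi'.
    have := ph _ _ ii'; rewrite hi hi' => /(_ erefl).
    by rewrite /hole /= /bump.
  + by apply: (lin_of_literal_in (l := ((i, j), false))); rewrite !inE eqxx.
  + by apply: (lin_of_literal_in (l := ((i', j), false))); rewrite !inE eqxx orbT.
- case/bigcupP => i _ /imset2P[j j' _]; rewrite inE => /= jj' ->.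
  apply: (alive_exclusion (u := (i, j)) (w := (i, j'))) => //=.
  + by move=> h _ -> /hole_inj E; rewrite E eqxx in jj'.
  + by apply: (lin_of_literal_in (l := ((i, j), false))); rewrite !inE eqxx.
  + by apply: (lin_of_literal_in (l := ((i, j'), false))); rewrite !inE eqxx orbT.
Qed.

Lemma alive_step d g S S' : (#|S|.+2 <= d)%N -> (d.*2 <= n)%N ->
  step (lin_of_cnf (FPHP n)) S S' -> alive d g S -> exists g', alive d g' S'.
Proof.
move=> Sd dn [C CF|C CS|C SC] al.
- exact: alive_download CF al.
- by exists g; apply: alive_erasure => //; lia.
- exact: alive_inference al SC.
Qed.

Lemma alive_start d : (d.*2 <= n)%N -> exists g, alive d g set0.
Proof.
move=> dn; exists (fun=> (0, 0)); split=> [C|]; first by rewrite inE.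
by rewrite conf_ind0 one_notin.
Qed.

(** An equation forcing the empty clause has no solution, so the indicator would be 0. *)
Lemma alive_empty d g S : alive d g S -> empty_linclause (pvar n) \notin S.
Proof.
move=> [gS]; apply: contra => /[dup] eS /gS /forallP f0.
rewrite (_ : conf_ind g S = 0) ?mem0v //; apply/ffunP => h; rewrite !ffunE.
case: andP => // -[_ /forall_inP/(_ _ eS) hh].
have := f0 (assignment h); rewrite hh => /exists_inP[e].
by rewrite inE.
Qed.

(** Take d = n/2. If the space were below n/2 - 1, the slack of two would persist and every
    configuration would be alive, the last one included. *)
Lemma refutation_space_ge pi :
  refutation (lin_of_cnf (FPHP n)) pi -> (n./2 <= (refutation_space pi).+1)%N.
Proof.
move=> [h0 hs hl]; rewrite leqNgt; apply/negP => small.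
have dn : (n./2.*2 <= n)%N by lia.
have bound i : (i < size pi)%N ->
    (#|nth (empty_configuration _) pi i| <= refutation_space pi)%N.
  by move=> ip; apply: (@leq_bigmax_seq _ pi xpredT (fun S => #|S|)); rewrite ?mem_nth.
have alive_nth i : (i < size pi)%N -> exists g, alive n./2 g (nth (empty_configuration _) pi i).
  elim: i => [|i IH] ip; first by rewrite nth0 h0; apply: alive_start.
  have [g al] := IH (ltnW ip); apply: alive_step dn (hs i ip) al.
  by have := bound i (ltnW ip); lia.
(* An empty sequence has the empty configuration as its default last element, which lacks the empty
   clause. *)
have [pi0|pi0] := posnP (size pi).
  by move: hl; rewrite (size0nil pi0) /= inE.
have [|g /alive_empty/negP[]] := alive_nth (size pi).-1; first by rewrite prednK.
by rewrite nth_last.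
Qed.

End Game.

(** * Existence of refutations *)

Section Completeness.
Variables (V : finType) (phi : lincnf V).
Implicit Types (S : configuration V) (C D : linclause V) (x : {ffun V -> 'F_2}).

Local Notation run0 := (empty_configuration V).
Let stepb S S' := `[< step phi S S' >].

Definition reachable S := exists2 s, path stepb run0 s & last run0 s = S.

(** Starting from an arbitrary reachable configuration and keeping all of it allows derivations to
    be chained. *)
Definition obtainable C := forall S, reachable S ->
  exists S', [/\ reachable S', S \subset S' & C \in S'].

Lemma reachable_step S S' : reachable S -> step phi S S' -> reachable S'.
Proof.
move=> [s sp sl] st; exists (rcons s S'); rewrite ?last_rcons // rcons_path sp /=.
by rewrite sl; apply/asboolP.
Qed.

Lemma obtainable_axiom C : C \in phi -> obtainable C.
Proof.
move=> Cphi S rS; exists (C |: S); split; rewrite ?subsetUr ?setU11 //.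
exact: reachable_step rS (Download _ Cphi).
Qed.

Lemma obtainable_weakening C D :
  obtainable C -> semantically_implies C D -> obtainable D.
Proof.
move=> oC CD S /oC[S' [rS' sub CS]].
exists (D |: S'); split; rewrite ?setU11 //; last exact: subset_trans sub (subsetUr _ _).
by apply: reachable_step rS' _; apply: Inference; apply: Weakening CS CD.
Qed.

Lemma obtainable_resolution (f : linform V) C :
  obtainable ((f, 0) |: C) -> obtainable ((f, 1) |: C) -> obtainable C.
Proof.
move=> o0 o1 S /o0[S0 [r0 sub0 C0]]; have [S1 [r1 sub1 C1]] := o1 _ r0.
exists (C |: S1); split; rewrite ?setU11 //; last first.
  by apply: subset_trans sub0 (subset_trans sub1 (subsetUr _ _)).
apply: reachable_step r1 _; apply: Inference; rewrite -{1}(setUid C).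
by apply: Resolution C1; apply: (subsetP sub1).
Qed.

(* The clause falsified exactly by the assignments agreeing with [x] on [W]. *)
Definition blocking x (W : {set V}) : linclause V :=
  [set (linform_var v, x v + 1) | v in W].

(** Downward induction on [W]. When [W] contains all variables the clause is a weakening of an axiom
    falsified by [x]; otherwise resolve on a variable outside [W]. *)
Lemma obtainable_blocking :
  (forall x, exists2 C, C \in phi & ~~ linsat x C) ->
  forall W x, obtainable (blocking x W).
Proof.
move=> unsat W; have [N] := ubnP #|~: W|; elim: N W => // N IH W WN x.
have [v vW|full] := pickP [predC W]; last first.
  have [C Cphi xC] := unsat x; apply: obtainable_weakening (obtainable_axiom Cphi) _.
  move=> y yC; have [v yv] : exists v, y v != x v.
    apply/existsP; apply: contraR xC => /existsPn yx.
    by rewrite (_ : x = y) //; apply/ffunP => v; have := yx v; rewrite negbK => /eqP.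
  apply/exists_inP; exists (linform_var v, x v + 1).
    by apply: imset_f; have := full v; rewrite /= => /negbFE.
  by rewrite eval_var -F2_neq.
pose set_v (t : 'F_2) : {ffun V -> 'F_2} := [ffun w => if w == v then t else x w].
have blockE t : blocking (set_v t) (v |: W) = (linform_var v, t + 1) |: blocking x W.
  rewrite /blocking imsetU1 ffunE eqxx; congr (_ |: _).
  apply: eq_in_imset => w wW; rewrite ffunE; case: eqP => // wv.
  by move: vW; rewrite /= -wv wW.
have WvN : (#|~: (v |: W)| < N)%N.
  have := cardsC W; have := cardsC (v |: W).
  by rewrite cardsU1 (_ : v \notin W) //; lia.
apply: (@obtainable_resolution (linform_var v)).
  have := IH _ WvN (set_v 1); rewrite blockE.
  by rewrite (_ : 1 + 1 = 0 :> 'F_2) //; apply: val_inj.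
by have := IH _ WvN (set_v 0); rewrite blockE add0r.
Qed.

(** Blocking on no variable gives the empty clause. Existence matters because [ResXorSpace] is 0 for
    a formula without refutations. *)
Lemma unsat_refutation :
  (forall x, exists2 C, C \in phi & ~~ linsat x C) -> exists pi, refutation phi pi.
Proof.
move=> unsat; have := obtainable_blocking unsat set0 0.
rewrite /blocking imset0 => o; have [|S [[s sp sl] _ eS]] := o run0; first by exists [::].
exists (run0 :: s); split => //= [i|]; last by rewrite sl.
by rewrite ltnS => is_; apply/asboolP; move/(pathP run0): sp; apply.
Qed.

End Completeness.

(** * Unsatisfiability of the pigeonhole formula and the bound on its space *)

Lemma lin_of_clause_sat (V : finType) (x : {ffun V -> 'F_2}) (D : clause V) :
  linsat x (lin_of_clause D) -> exists2 l, l \in D & x l.1 = l.2%:R.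
Proof.
by case/exists_inP => _ /imsetP[l lD ->]; rewrite eval_var => /eqP; exists l.
Qed.

(** The pigeon axioms give a map from [n.+1] pigeons to [n] holes, and the hole axioms make it
    injective. *)
Lemma FPHP_unsat n (x : {ffun pvar n -> 'F_2}) :
  exists2 C, C \in lin_of_cnf (FPHP n) & ~~ linsat x C.
Proof.
apply/exists_inP; apply: contraT; rewrite negb_exists_in => /forall_inP sat.
have {}sat D : D \in FPHP n -> exists2 l, l \in D & x l.1 = l.2%:R.
  by move=> DF; apply: lin_of_clause_sat; rewrite -[linsat _ _]negbK sat // imset_f.
have /fin_all_exists[f xf] i : exists j, x (i, j) = 1.
  have [|_ /imsetP[j _ ->] xij] := sat [set ((i, j), true) | j : 'I_n].
    by rewrite !inE (imset_f (fun i => [set ((i, j), true) | j : 'I_n])).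
  by exists j.
have /leq_card : injective f.
  move=> i i' E; apply/eqP; apply: contraT => ii'.
  have [|l] := sat [set ((i, f i), false); ((i', f i), false)].
    rewrite !inE; apply/orP; left; apply/orP; right.
    by apply/bigcupP; exists (f i) => //; apply/imset2P; exists i i'; rewrite ?inE.
  by rewrite !inE => /orP[] /eqP -> /=; [|rewrite E]; rewrite xf.
by rewrite !card_ord ltnn.
Qed.

Lemma ResXorSpace_FPHP n : (n./2 <= (ResXorSpace (lin_of_cnf (FPHP n))).+1)%N.
Proof.
rewrite /ResXorSpace; case: pselect => [ex|[]].
  by case: ex_minnP => s /asboolP[pi [rpi <-]] _; apply: refutation_space_ge.
have [pi rpi] := unsat_refutation (@FPHP_unsat n).
by exists (refutation_space pi); apply/asboolP; exists pi.
Qed.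

From mathcomp Require Import classical_sets reals topology normedtype landau.
Import numFieldNormedType.Exports.
Local Open Scope classical_set_scope.
Local Open Scope ring_scope.

Theorem theorem4p14 (R : realType) :
  (fun n : nat => (ResXorSpace (lin_of_cnf (FPHP n)))%:R : R^o)
    \is 'Omega_\oo (fun n : nat => n%:R : R^o).
Proof.
(* From n = 6 on, [n./2 - 1] is at least n/4. *)
rewrite qualifE; apply/asboolP; exists 4%:R^-1; first by rewrite invr_gt0.
exists 6%N => // n /= n6.
rewrite !normr_nat mulrC ler_pdivrMr // -natrM ler_nat.
have := ResXorSpace_FPHP n; lia.
Qed.
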